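(* Let $H,Q:\mathbb{R}^n\to\mathbb{R}^n$ be Lipschitz continuous with constants $L_H$ and $L_Q$, respectively, let $\eta>0$, and let $K:\mathbb{R}^n\rightrightarrows\mathbb{R}^n$ be a set-valued map with nonempty, closed and convex values. Suppose that there exist $L_v,L_K>0$ such that $$\|P_{K(x)}(u)-P_{K(y)}(v)\|\le L_v\|u-v\|+L_K\|x-y\|\qquad\text{for all }x,y,u,v\in\mathbb{R}^n .$$ Then the moving-set residual $R_\eta^q(x):=H(x)-P_{K(x)}\big(H(x)-\eta Q(x)\big)$ satisfies $$\|R_\eta^q(x)-R_\eta^q(y)\|\le\big(L_H+L_v(L_H+\eta L_Q)+L_K\big)\|x-y\|\qquad\text{for all }x,y\in\mathbb{R}^n,$$ i.e. $R_\eta^q$ is Lipschitz continuous with a constant $L_R^q\le L_H+L_v(L_H+\eta L_Q)+L_K$.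
   Context: $\|\cdot\|$ is the Euclidean norm on $\mathbb{R}^n$, and for $x\in\mathbb{R}^n$, $P_{K(x)}$ is the Euclidean projection onto the nonempty closed convex set $K(x)$. ($R_\eta^q$ is the residual associated with the generalized quasi-variational inequality: find $x^*$ such that $H(x^* )\in K(x^* )$ and $\langle y-H(x^* ),Q(x^* )\rangle\ge0$ for all $y\in K(x^* )$.) *)

(* Defs.v *)
From HB Require Import structures.
From mathcomp Require Import all_boot all_order all_algebra.
From mathcomp Require Import boolp classical_sets reals topology.
From mathcomp Require Import normedtype convex.

Set Implicit Arguments.
Unset Strict Implicit.
Unset Printing Implicit Defensive.

Import Order.TTheory GRing.Theory Num.Theory.
Import numFieldNormedType.Exports.

Local Open Scope classical_set_scope.
Local Open Scope ring_scope.

(* The canonical norm `|x| on 'rV[R]_n is the sup norm, so the Euclidean norm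
   is introduced separately. Both norms induce the same topology on 'rV[R]_n,
   hence [closed] may be taken with respect to the canonical one. *)
Definition enorm (R : realType) (n : nat) (x : 'rV[R]_n) : R :=
  Num.sqrt (\sum_i x 0 i ^+ 2).

(* The library's k.-lipschitz predicate refers to the canonical (sup) norm. *)
Definition elipschitz (R : realType) (n : nat) (L : R)
    (f : 'rV[R]_n -> 'rV[R]_n) : Prop :=
  0 <= L /\ forall x y, enorm (f x - f y) <= L * enorm (x - y).

Definition nearest_points (R : realType) (n : nat)
    (C : set 'rV[R]_n) (u : 'rV[R]_n) : set 'rV[R]_n :=
  [set p | C p /\ forall q, C q -> enorm (u - p) <= enorm (u - q)].

(* For C nonempty, closed and convex, [nearest_points C u] is a singleton; the
   default value 0 is only reached when there is no nearest point. *)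
Definition eproj (R : realType) (n : nat)
    (C : set 'rV[R]_n) (u : 'rV[R]_n) : 'rV[R]_n :=
  xget 0 (nearest_points C u).

Definition residual (R : realType) (n : nat) (eta : R)
    (H Q : 'rV[R]_n -> 'rV[R]_n) (K : 'rV[R]_n -> set 'rV[R]_n)
    (x : 'rV[R]_n) : 'rV[R]_n :=
  H x - eproj (K x) (H x - eta *: Q x).

(* Main.v *)
Require Import Defs.
From HB Require Import structures.
From mathcomp Require Import all_boot all_order all_algebra.
From mathcomp Require Import boolp classical_sets reals topology.
From mathcomp Require Import normedtype convex.
From mathcomp Require Import ring lra.

(** The residual is a difference of two Lipschitz maps.  Its first term varies
    by at most [L_H * enorm (x - y)].  For its second term the assumption on the
    moving projections is used with [u] and [v] the forward steps
    [H x - eta *: Q x] and [H y - eta *: Q y], and the forward step is itself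
    Lipschitz with constant [L_H + eta * L_Q].  Both estimates rest on the
    triangle inequality for the Euclidean norm ([ler_enormD]), which is derived
    from the Cauchy-Schwarz inequality ([sum_mul_le_enorm]). *)

Set Implicit Arguments.
Unset Strict Implicit.
Unset Printing Implicit Defensive.

Import Order.TTheory GRing.Theory Num.Theory.
Import numFieldNormedType.Exports.

Local Open Scope classical_set_scope.
Local Open Scope ring_scope.

Lemma enorm_ge0 (R : realType) (n : nat) (x : 'rV[R]_n) : 0 <= enorm x.
Proof. exact: sqrtr_ge0. Qed.

Lemma sqr_enorm (R : realType) (n : nat) (x : 'rV[R]_n) :
  enorm x ^+ 2 = \sum_i x 0 i ^+ 2.
Proof. by rewrite sqr_sqrtr // sumr_ge0 // => i _; exact: sqr_ge0. Qed.

Lemma enorm_eq0 (R : realType) (n : nat) (x : 'rV[R]_n) :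
  enorm x = 0 -> x = 0.
Proof.
move=> x0; have /eqP := sqr_enorm x.
rewrite x0 expr0n /= eq_sym psumr_eq0 => [/allP xi0|i _]; last exact: sqr_ge0.
apply/rowP => i; rewrite mxE; apply/eqP.
by rewrite -sqrf_eq0; apply: xi0; rewrite mem_index_enum.
Qed.

Lemma enormZ (R : realType) (n : nat) (c : R) (x : 'rV[R]_n) :
  enorm (c *: x) = `|c| * enorm x.
Proof.
rewrite /enorm; under eq_bigr do rewrite mxE exprMn.
by rewrite -mulr_sumr sqrtrM ?sqr_ge0 // sqrtr_sqr.
Qed.

(** With [a := enorm x] and [b := enorm y], expanding
    [0 <= \sum_i (b * x 0 i - a * y 0 i) ^+ 2] bounds [a * b] times the inner
    product by [(a * b) ^+ 2]; one divides by [a * b], which vanishes only if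
    one of the two vectors is zero. *)
Lemma sum_mul_le_enorm (R : realType) (n : nat) (x y : 'rV[R]_n) :
  \sum_i x 0 i * y 0 i <= enorm x * enorm y.
Proof.
have [/enorm_eq0 ->|a0] := eqVneq (enorm x) 0.
  rewrite big1 ?mulr_ge0 ?enorm_ge0 // => i _.
  by rewrite mxE mul0r.
have [/enorm_eq0 ->|b0] := eqVneq (enorm y) 0.
  rewrite big1 ?mulr_ge0 ?enorm_ge0 // => i _.
  by rewrite mxE mulr0.
have ab_gt0 : 0 < enorm x * enorm y.
  by rewrite mulr_gt0 // lt0r enorm_ge0 ?a0 ?b0.
rewrite -(ler_pM2l ab_gt0).
have : 0 <= \sum_i (enorm y * x 0 i - enorm x * y 0 i) ^+ 2.
  by apply: sumr_ge0 => i _; exact: sqr_ge0.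
have -> : \sum_i (enorm y * x 0 i - enorm x * y 0 i) ^+ 2 =
    enorm y ^+ 2 * (\sum_i x 0 i ^+ 2) + enorm x ^+ 2 * (\sum_i y 0 i ^+ 2)
    - 2 * (enorm x * enorm y) * \sum_i x 0 i * y 0 i.
  rewrite !mulr_sumr -sumrN -!big_split /=.
  by apply: eq_bigr => i _; ring.
rewrite -!sqr_enorm.
set S := \sum_i _.
by nra.
Qed.

Lemma ler_enormD (R : realType) (n : nat) (x y : 'rV[R]_n) :
  enorm (x + y) <= enorm x + enorm y.
Proof.
rewrite -(@ler_pXn2r _ 2) ?nnegrE ?addr_ge0 ?enorm_ge0 // sqr_enorm.
have -> : \sum_i (x + y) 0 i ^+ 2 =
    \sum_i x 0 i ^+ 2 + \sum_i y 0 i ^+ 2 + 2 * \sum_i x 0 i * y 0 i.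
  rewrite mulr_sumr -!big_split /=.
  by apply: eq_bigr => i _; rewrite mxE; ring.
rewrite -!sqr_enorm.
have := sum_mul_le_enorm x y.
set S := \sum_i _.
by nra.
Qed.

Lemma ler_enormB (R : realType) (n : nat) (x y : 'rV[R]_n) :
  enorm (x - y) <= enorm x + enorm y.
Proof.
apply: le_trans (ler_enormD _ _) _.
by rewrite -scaleN1r enormZ normrN1 mul1r.
Qed.

Lemma elipschitzB (R : realType) (n : nat) (L M : R)
    (f g : 'rV[R]_n -> 'rV[R]_n) :
  elipschitz L f -> elipschitz M g -> elipschitz (L + M) (fun x => f x - g x).
Proof.
move=> [L0 fL] [M0 gM]; split=> [|x y]; first exact: addr_ge0.
have -> : f x - g x - (f y - g y) = (f x - f y) - (g x - g y).
  by rewrite !opprB addrACA [RHS]addrACA [- g x + _]addrC [- f y + _]addrC.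
by rewrite mulrDl (le_trans (ler_enormB _ _)) // lerD.
Qed.

Lemma elipschitzZ (R : realType) (n : nat) (c L : R)
    (f : 'rV[R]_n -> 'rV[R]_n) :
  0 <= c -> elipschitz L f -> elipschitz (c * L) (fun x => c *: f x).
Proof.
move=> c0 [L0 fL]; split=> [|x y]; first exact: mulr_ge0.
by rewrite -scalerBr enormZ ger0_norm // -mulrA ler_wpM2l.
Qed.

Theorem mainTheorem5 (R : realType) (n : nat)
    (H Q : 'rV[R]_n -> 'rV[R]_n) (L_H L_Q eta : R)
    (K : 'rV[R]_n -> set 'rV[R]_n) (L_v L_K : R)
    (HLip : elipschitz L_H H) (QLip : elipschitz L_Q Q)
    (eta_gt0 : 0 < eta)
    (K_nonempty : forall x, K x !=set0)
    (K_closed : forall x, closed (K x))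
    (K_convex : forall x, convex_set (K x))
    (L_v_gt0 : 0 < L_v) (L_K_gt0 : 0 < L_K)
    (projK : forall x y u v : 'rV[R]_n,
      enorm (eproj (K x) u - eproj (K y) v)
        <= L_v * enorm (u - v) + L_K * enorm (x - y)) :
  (forall x y : 'rV[R]_n,
    enorm (residual eta H Q K x - residual eta H Q K y)
      <= (L_H + L_v * (L_H + eta * L_Q) + L_K) * enorm (x - y)) /\
  (exists L_R : R, L_R <= L_H + L_v * (L_H + eta * L_Q) + L_K /\
    elipschitz L_R (residual eta H Q K)).
Proof.
have [step_ge0 stepL] := elipschitzB HLip (elipschitzZ (ltW eta_gt0) QLip).
have projL : elipschitz (L_v * (L_H + eta * L_Q) + L_K)
    (fun x => eproj (K x) (H x - eta *: Q x)).
  split=> [|x y]; first by rewrite addr_ge0 ?mulr_ge0 // ltW.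
  rewrite (le_trans (projK _ _ _ _)) // mulrDl lerD2r -mulrA.
  by rewrite ler_wpM2l // ltW.
have resL := elipschitzB HLip projL; rewrite addrA in resL.
split; first by case: resL.
by exists (L_H + L_v * (L_H + eta * L_Q) + L_K).
Qed.
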